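(* Let $x$ be an element of $\mathfrak{S}_n$ and let $\sigma$ be the corresponding inner automorphism of $\mathfrak{S}_n$, $\sigma(y)=xyx^{-1}$ for all $y\in\mathfrak{S}_n$. If $x$ has order $2$, then $|S_\sigma|=|S_I|$.
   Context: $\mathfrak{S}_n$ is the symmetric group on $n$ elements. For an automorphism $\sigma$ of $\mathfrak{S}_n$, $S_\sigma=\{y\in\mathfrak{S}_n\mid \sigma(y)=y^{-1}\}$. $I$ denotes the identity automorphism, so $S_I=\{y\in\mathfrak{S}_n\mid y \text{ has order } 1 \text{ or } 2\}$. *)

(* Defs.v *)
From mathcomp Require Import all_boot all_fingroup cyclic.
Set Implicit Arguments.
Unset Strict Implicit.
Unset Printing Implicit Defensive.
Local Open Scope group_scope.

(* The product of permutations is read left to right: (s * t) i = t (s i). *)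

(* [s ^ t] is [t^-1 * s * t], hence the inverse on [x]. *)
Definition inner_aut n (x : 'S_n) : {perm 'S_n} := conj_aut [set: 'S_n] x^-1.

Lemma inner_autE n (x y : 'S_n) : inner_aut x y = x * y * x^-1.
Proof.
rewrite norm_conj_autE ?inE ?conjgE ?invgK ?mulgA //.
exact: subsetT.
Qed.

Lemma inner_aut_Aut n (x : 'S_n) : inner_aut x \in Aut [set: 'S_n].
Proof. exact: Aut_aut. Qed.

(* Used for [sigma \in Aut [set: 'S_n]]; the identity automorphism is [1]. *)
Definition inverted n (sigma : {perm 'S_n}) : {set 'S_n} :=
  [set y | sigma y == y^-1].

Lemma inverted1 n (y : 'S_n) :
  (y \in inverted 1) = (#[y] == 1%N) || (#[y] == 2).
Proof.
rewrite inE perm1 eq_sym eq_invg_mul -expg2 -order_dvdn.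
apply/idP/idP => [dvd_y2|/orP[]/eqP-> //].
by move: (dvdn_leq (isT : 0 < 2) dvd_y2) (order_gt0 y); case: #[y] => [|[|[]]].
Qed.

(* Main.v *)
Require Import Defs.
From mathcomp Require Import all_boot all_fingroup.
Local Open Scope group_scope.

(** Since [x] is an involution, conjugation by [x] inverts [y] exactly when [x * y] is its own
    inverse. So [inverted (inner_aut x)] is the preimage of [inverted 1] under left translation by
    [x], a bijection. *)

Theorem corollary3p6 (n : nat) (x : 'S_n) (hx : #[x] = 2) :
  #|inverted (inner_aut x)| = #|inverted (1 : {perm 'S_n})|.
Proof.
have xV : x^-1 = x by apply/eqP; rewrite eq_invg_mul -expg2 -hx expg_order.
(* As x = x^-1, the equation x y x^-1 = y^-1 says (x y)^2 = 1. *)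
rewrite -(card_preimset (inverted 1) (mulgI x)); congr #|pred_of_set _|.
apply/setP => y; rewrite !inE inner_autE perm1 invMg.
(* Right multiplication by [x] turns the first equation into [x * y = y^-1 * x]; the second,
   [x * y = y^-1 * x^-1], is the same because [x^-1 = x]. *)
by rewrite -(inj_eq (mulIg x)) mulgKV xV.
Qed.
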